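(* Let $\widehat{A}=A+\varepsilon B$ be an $n\times n$ dual matrix with $A,B\in\mathbb{R}^{n\times n}$ and $\mathrm{rank}(A)=r$, and suppose the dual core generalized inverse $\widehat{A}^{\mathrm{c}}$ of $\widehat{A}$ exists. Then $\widehat{A}^{\mathrm{c}}=A^{\mathrm{c}}-\varepsilon A^{\mathrm{c}}BA^{\mathrm{c}}$ if and only if $\mathrm{Ind}(A)=1$ and $(I_n-AA^{+})B=0$.
   Context: Dual numbers are $a+\varepsilon a'$ with $a,a'\in\mathbb{R}$ and $\varepsilon\neq 0$, $\varepsilon^2=0$ (i.e. the ring $\mathbb{R}[\varepsilon]/(\varepsilon^2)$). A dual matrix is a matrix over dual numbers, written $\widehat{A}=A+\varepsilon B$ with $A,B$ real; its transpose is $\widehat{A}^{T}=A^{T}+\varepsilon B^{T}$. The dual core generalized inverse (DCGI) $\widehat{A}^{\mathrm{c}}$ of an $n\times n$ dual matrix $\widehat{A}$ is the (unique, if it exists) dual matrix $\widehat{G}$ with $\widehat{A}\widehat{G}\widehat{A}=\widehat{A}$, $\widehat{A}\widehat{G}^2=\widehat{G}$, $(\widehat{A}\widehat{G})^{T}=\widehat{A}\widehat{G}$. For a real square matrix $A$, ''$\mathrm{Ind}(A)=1$'' means $\mathrm{rank}(A^2)=\mathrm{rank}(A)$; in that case the core inverse $A^{\mathrm{c}}$ is the unique real $X$ with $AXA=A$, $AX^2=X$, $(AX)^{T}=AX$. $A^{+}$ is the real Moore–Penrose inverse of $A$. (If the DCGI of $\widehat{A}$ exists then $A^{\mathrm{c}}$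 exists.) *)

(* Defs.v *)
From HB Require Import structures.
From mathcomp Require Import all_boot all_order all_algebra.
From mathcomp Require Import all_classical all_reals.

Set Implicit Arguments.
Unset Strict Implicit.
Unset Printing Implicit Defensive.

Import Order.TTheory GRing.Theory Num.Theory.
Local Open Scope ring_scope.

(* Dual a a' is a + eps a'. A fresh type is needed because the canonical ring
   structure on R * R is the componentwise one. *)
Record dual (R : Type) := Dual { dual_std : R; dual_inf : R }.

Definition dual_to_pair (R : Type) (x : dual R) := (dual_std x, dual_inf x).
Definition dual_of_pair (R : Type) (p : R * R) := Dual p.1 p.2.
Lemma dual_to_pairK (R : Type) : cancel (@dual_to_pair R) (@dual_of_pair R).
Proof. by case. Qed.

HB.instance Definition _ (R : choiceType) :=
  Choice.copy (dual R) (can_type (@dual_to_pairK R)).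

Section DualRing.
Context (R : comNzRingType).
Implicit Types x y z : dual R.

Definition dual_add x y :=
  Dual (dual_std x + dual_std y) (dual_inf x + dual_inf y).
Definition dual_opp x := Dual (- dual_std x) (- dual_inf x).
Definition dual_mul x y :=
  Dual (dual_std x * dual_std y)
       (dual_std x * dual_inf y + dual_inf x * dual_std y).

Fact dual_addA : associative dual_add.
Proof. by move=> x y z; rewrite /dual_add /= !addrA. Qed.
Fact dual_addC : commutative dual_add.
Proof. by move=> x y; congr Dual; rewrite addrC. Qed.
Fact dual_add0 : left_id (Dual 0 0) dual_add.
Proof. by case=> a b; rewrite /dual_add /= !add0r. Qed.
Fact dual_addN : left_inverse (Dual 0 0) dual_opp dual_add.
Proof. by case=> a b; rewrite /dual_add /= !addNr. Qed.

HB.instance Definition _ :=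
  GRing.isZmodule.Build (dual R) dual_addA dual_addC dual_add0 dual_addN.

Fact dual_mulA : associative dual_mul.
Proof.
by move=> x y z; rewrite /dual_mul /= !mulrDr !mulrDl !mulrA addrA.
Qed.
Fact dual_mulC : commutative dual_mul.
Proof.
move=> x y; congr Dual; first by rewrite mulrC.
by rewrite addrC; congr (_ + _); rewrite mulrC.
Qed.
Fact dual_mul1 : left_id (Dual 1 0) dual_mul.
Proof. by case=> a b; rewrite /dual_mul /= !mul1r mul0r addr0. Qed.
Fact dual_mulDl : left_distributive dual_mul dual_add.
Proof.
by move=> x y z; congr Dual; rewrite /= !mulrDl // addrACA.
Qed.
Fact dual_one_neq0 : Dual 1 0 != 0 :> dual R.
Proof. by apply/eqP => -[] /eqP; rewrite oner_eq0. Qed.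

HB.instance Definition _ := GRing.Zmodule_isComNzRing.Build (dual R)
  dual_mulA dual_mulC dual_mul1 dual_mulDl dual_one_neq0.

Definition eps : dual R := Dual 0 1.
Definition dual_of (a : R) : dual R := Dual a 0.

Lemma eps_neq0 : eps != 0.
Proof. by apply/eqP => -[] /eqP; rewrite oner_eq0. Qed.

Lemma eps_sqr : eps ^+ 2 = 0.
Proof. by rewrite expr2; congr Dual => /=; rewrite !(mul0r, mulr0, addr0). Qed.

Lemma dualE (a b : R) : Dual a b = dual_of a + eps * dual_of b.
Proof. by congr Dual; rewrite /= !(mul0r, mul1r, mulr0, addr0, add0r). Qed.

End DualRing.

Arguments eps {R}.

Notation "A %:D" := (map_mx (@dual_of _) A)
  (at level 1, left associativity, format "A %:D") : ring_scope.

(* Stated over an arbitrary commutative ring: T = R gives the core inverse and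
   T = dual R the dual core generalized inverse. *)
Definition is_core_inverse (T : comNzRingType) (n : nat) (A X : 'M[T]_n) : Prop :=
  [/\ A *m X *m A = A,
      A *m (X *m X) = X
    & (A *m X)^T = A *m X].

(* The core inverse when there is one (it need not exist); 0 otherwise. *)
Definition core_inverse (T : comNzRingType) (n : nat) (A : 'M[T]_n) : 'M[T]_n :=
  xget 0 [set X | is_core_inverse A X]%classic.

Definition is_moore_penrose (R : realType) (m n : nat)
    (A : 'M[R]_(m, n)) (X : 'M[R]_(n, m)) : Prop :=
  [/\ A *m X *m A = A,
      X *m A *m X = X,
      (A *m X)^T = A *m X
    & (X *m A)^T = X *m A].

Definition moore_penrose (R : realType) (m n : nat) (A : 'M[R]_(m, n)) :
    'M[R]_(n, m) :=
  xget 0 [set X | is_moore_penrose A X]%classic.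

Definition index_one (R : realType) (n : nat) (A : 'M[R]_n) : Prop :=
  \rank (A *m A) = \rank A.

(* Main.v *)
Require Import Defs.
From HB Require Import structures.
From mathcomp Require Import all_boot all_order all_algebra.
From mathcomp Require Import all_classical all_reals.

Set Implicit Arguments.
Unset Strict Implicit.
Unset Printing Implicit Defensive.

Import Order.TTheory GRing.Theory Num.Theory.
Local Open Scope ring_scope.

(** Splitting the defining equations of a dual core inverse X + eps Y of
    A + eps B into components shows that X is the core inverse of A and that Y
    solves an affine system whose homogeneous part (A D A = 0,
    A (X D + D X) = D, A D symmetric) has only the zero solution, because
    X A^2 = A. Substituting Y = - X B X, the whole system reduces to
    (1 - A X) B = 0, and A X = A A^+ since both are the orthogonal projector
    onto the column space of A. *)

Section DualOfMorphism.
Context (R : comNzRingType).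

(** What makes [map_mxM], [map_mxD] and [map_mxN] available for [%:D]. *)
Fact dual_of_is_zmod_morphism : zmod_morphism (@dual_of R).
Proof. by move=> a b; congr Dual; rewrite /= subr0. Qed.

Fact dual_of_is_monoid_morphism : monoid_morphism (@dual_of R).
Proof. by split=> // a b; congr Dual; rewrite /= mulr0 mul0r addr0. Qed.

HB.instance Definition _ := GRing.isZmodMorphism.Build R (dual R)
  (@dual_of R) dual_of_is_zmod_morphism.
HB.instance Definition _ := GRing.isMonoidMorphism.Build R (dual R)
  (@dual_of R) dual_of_is_monoid_morphism.

End DualOfMorphism.

Section DualMatrix.
Context (R : comNzRingType).

Lemma dual_mx_entry (m n : nat) (A B : 'M[R]_(m, n)) i j :
  (A%:D + eps *: B%:D) i j = Dual (A i j) (B i j).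
Proof. by rewrite !mxE -dualE. Qed.

Lemma dual_mx_inj (m n : nat) (A B C D : 'M[R]_(m, n)) :
  A%:D + eps *: B%:D = C%:D + eps *: D%:D -> A = C /\ B = D.
Proof.
move=> eqM; have eqD i j : Dual (A i j) (B i j) = Dual (C i j) (D i j).
  by rewrite -!dual_mx_entry eqM.
by split; apply/matrixP => i j; case: (eqD i j).
Qed.

Lemma dual_mxP (m n : nat) (M : 'M[dual R]_(m, n)) :
  exists A B : 'M[R]_(m, n), M = A%:D + eps *: B%:D.
Proof.
exists (map_mx (@dual_std R) M), (map_mx (@dual_inf R) M).
by apply/matrixP => i j; rewrite dual_mx_entry !mxE; case: (M i j).
Qed.

Lemma mul_dual_mx (m n p : nat) (A B : 'M[R]_(m, n)) (C D : 'M[R]_(n, p)) :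
  (A%:D + eps *: B%:D) *m (C%:D + eps *: D%:D)
    = (A *m C)%:D + eps *: (A *m D + B *m C)%:D.
Proof.
rewrite mulmxDl !mulmxDr -!scalemxAl -!scalemxAr scalerA -expr2 eps_sqr scale0r.
by rewrite addr0 -!map_mxM -addrA -scalerDr -map_mxD.
Qed.

Lemma tr_dual_mx (m n : nat) (A B : 'M[R]_(m, n)) :
  (A%:D + eps *: B%:D)^T = A^T%:D + eps *: B^T%:D.
Proof. by apply/matrixP => i j; rewrite mxE !dual_mx_entry !mxE. Qed.

Lemma is_core_inverse_dual (n : nat) (A B X Y : 'M[R]_n) :
  is_core_inverse (A%:D + eps *: B%:D) (X%:D + eps *: Y%:D) <->
  is_core_inverse A X /\
  [/\ A *m X *m B + (A *m Y + B *m X) *m A = B,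
      A *m (X *m Y + Y *m X) + B *m (X *m X) = Y
    & (A *m Y + B *m X)^T = A *m Y + B *m X].
Proof.
(* Kept opaque: rewriting under the unfolded sums is prohibitively slow. *)
pose d (P Q : 'M[R]_n) := P%:D + eps *: Q%:D.
have dM P Q S T : d P Q *m d S T = d (P *m S) (P *m T + Q *m S).
  exact: mul_dual_mx.
have dT P Q : (d P Q)^T = d P^T Q^T by exact: tr_dual_mx.
have dI P Q S T : d P Q = d S T -> P = S /\ Q = T by exact: dual_mx_inj.
rewrite -/(d A B) -/(d X Y); clearbody d.
rewrite /is_core_inverse !dM dT.
split; first by case=> /dI[a1 b1] /dI[a2 b2] /dI[a3 b3].
by case=> -[-> -> ->] [-> -> ->].
Qed.

End DualMatrix.

(** By symmetry [A X = (A Y A X)^T = A X A Y = A Y]. *)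
Lemma eq_left_projector (R : comNzRingType) (m n : nat)
    (A : 'M[R]_(m, n)) (X Y : 'M[R]_(n, m)) :
  A *m X *m A = A -> (A *m X)^T = A *m X ->
  A *m Y *m A = A -> (A *m Y)^T = A *m Y -> A *m X = A *m Y.
Proof.
move=> AXA AXT AYA AYT.
by rewrite -AXT -{1}AYA -mulmxA trmx_mul AXT AYT mulmxA AXA.
Qed.

Section CoreInverse.
Context (F : fieldType) (n : nat).
Implicit Types A B X Y : 'M[F]_n.

(** [A = A X A] factors through [A^2], because [X = A X^2]. *)
Lemma core_inverse_rank A X :
  is_core_inverse A X -> \rank (A *m A) = \rank A.
Proof.
move=> [AXA AXX _]; apply/eqP; rewrite eqn_leq mxrankM_maxl /=.
have defA : A = A *m A *m (X *m X *m A).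
  by rewrite mulmxA -(mulmxA A A) AXX AXA.
by rewrite {1}defA mxrankM_maxl.
Qed.

(** Equality of ranks gives [A = Z A^2] for some [Z]. Then [X = A X^2 = Z A^2 X^2 = Z A X], whence
    [X A^2 = Z A X A A = Z A^2 = A]. *)
Lemma core_inverse_mulmx_sqr A X : is_core_inverse A X -> X *m (A *m A) = A.
Proof.
move=> cX; have [AXA AXX _] := cX.
have /submxP[Z defA] : (A <= A *m A)%MS.
  have [_ <-] := mxrank_leqif_sup (submxMl A A).
  by rewrite (core_inverse_rank cX).
have defX : X = Z *m (A *m X).
  by rewrite -[in LHS]AXX [in LHS]defA -!mulmxA AXX.
by rewrite [in LHS]defX mulmxA -(mulmxA Z) AXA -mulmxA -defA.
Qed.

(** Since [X A^2 = A], the product [X A] fixes the column space of [A], on which the projector [A X]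
    is the identity. *)
Lemma core_inverse_mulmxK A X (m : nat) (M : 'M[F]_(n, m)) :
  is_core_inverse A X -> A *m X *m M = M -> X *m A *m M = M.
Proof.
move=> cX AXM; rewrite -AXM !mulmxA -(mulmxA X).
by rewrite (core_inverse_mulmx_sqr cX).
Qed.

Lemma core_inverse_uniq A X Y :
  is_core_inverse A X -> is_core_inverse A Y -> X = Y.
Proof.
move=> cX cY; have [AXA AXX AXT] := cX; have [AYA AYY AYT] := cY.
have AX_AY : A *m X = A *m Y by exact: eq_left_projector.
(* The columns of [X = A X^2] and [Y = A Y^2] lie in the column space of [A], so [X A] fixes
   both. *)
have XAX : X *m A *m X = X by apply: core_inverse_mulmxK; rewrite // -mulmxA.
have XAY : X *m A *m Y = Y.
  by apply: core_inverse_mulmxK; rewrite // AX_AY -mulmxA.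
by rewrite -XAX -mulmxA AX_AY mulmxA XAY.
Qed.

(** Symmetry gives [A D = A X A D = (A D A X)^T = 0]. The second equation then reads [A X D = D], so
    [D = X A D = 0]. *)
Lemma core_inverse_homogeneous A X D :
  is_core_inverse A X -> A *m D *m A = 0 ->
  A *m (X *m D + D *m X) = D -> (A *m D)^T = A *m D -> D = 0.
Proof.
move=> cX ADA AXD ADT; have [AXA _ AXT] := cX.
have AD0 : A *m D = 0.
  by rewrite -[in LHS]AXA -(mulmxA (A *m X)) -AXT -ADT -trmx_mul mulmxA ADA mul0mx trmx0.
rewrite mulmxDr !mulmxA AD0 mul0mx addr0 in AXD.
by rewrite -(core_inverse_mulmxK cX AXD) -mulmxA AD0 mulmx0.
Qed.

Lemma dual_core_inverse_uniq (M G H : 'M[dual F]_n) :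
  is_core_inverse M G -> is_core_inverse M H -> G = H.
Proof.
have [A [B ->]] := dual_mxP M.
have [X [Y ->]] := dual_mxP G; have [X' [Z ->]] := dual_mxP H.
move=> /is_core_inverse_dual[cX [Y1 Y2 Y3]].
move=> /is_core_inverse_dual[cX' [Z1 Z2 Z3]].
rewrite -(core_inverse_uniq cX cX') in Z1 Z2 Z3 *.
(* The standard parts agree, so the terms in [B] cancel in the difference of the two affine
   systems. *)
suff /eqP : Y - Z = 0 by rewrite subr_eq0 => /eqP ->.
apply: (core_inverse_homogeneous cX).
- rewrite mulmxBr mulmxBl; apply/eqP; rewrite subr_eq0; apply/eqP.
  have := etrans Y1 (esym Z1); rewrite !mulmxDl.
  by move=> /addrI/addIr.
- rewrite mulmxBr mulmxBl addrACA -opprD mulmxBr.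
  by rewrite -[in RHS]Y2 -[in RHS]Z2 opprD addrACA subrr addr0.
- have -> : A *m (Y - Z) = (A *m Y + B *m X) - (A *m Z + B *m X).
    by rewrite mulmxBr opprD addrACA subrr addr0.
  by rewrite linearB /= Y3 Z3.
Qed.

Lemma is_core_inverse_dual_first_order A B X : is_core_inverse A X ->
  is_core_inverse (A%:D + eps *: B%:D) (X%:D + eps *: (- (X *m B *m X))%:D)
  <-> A *m X *m B = B.
Proof.
move=> cX; have [AXA AXX _] := cX.
have XAA := core_inverse_mulmx_sqr cX.
split=> [/is_core_inverse_dual[_ [h1 h2 _]]|AXB].
  (* With [E = B - A X B], the second equation yields [E X^2 = 0] and the first [E = E X A].
     Replacing [A] by [X A^2] gives [E = E X^2 A^2 = 0]. *)
  have EXX : (B - A *m X *m B) *m X *m X = 0.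
    move: h2; rewrite mulmxDr !(mulmxN, mulNmx) !mulmxA -(mulmxA A X X) AXX.
    by rewrite -addrA -[RHS]addr0 => /addrI; rewrite !mulmxBl addrC.
  have EXA : B - A *m X *m B = (B - A *m X *m B) *m (X *m A).
    rewrite -{1}h1 addrAC subrr add0r mulmxN !mulmxA.
    by rewrite !mulmxBl mulmxDl mulNmx addrC.
  apply/esym/eqP; rewrite -subr_eq0 EXA.
  by rewrite -[A in X *m A]XAA !mulmxA EXX !mul0mx.
apply/is_core_inverse_dual; split=> //.
have -> : A *m - (X *m B *m X) + B *m X = 0.
  by rewrite mulmxN !mulmxA AXB addNr.
rewrite mul0mx addr0 trmx0; split=> //.
by rewrite mulmxDr !(mulmxN, mulNmx) !mulmxA -(mulmxA A X X) AXX AXB addrNK.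
Qed.

End CoreInverse.

Lemma core_inverseP (T : comNzRingType) (n : nat) (A : 'M[T]_n) :
  (exists X, is_core_inverse A X) -> is_core_inverse A (core_inverse A).
Proof. by case=> X cX; apply: (xgetPex 0 (ex_intro _ X cX)). Qed.

(** Each diagonal entry of [N N^T] is the sum of the squares of a row of [N]. *)
Lemma mulmx_tr_eq0 (R : realDomainType) (m n : nat) (N : 'M[R]_(m, n)) :
  N *m N^T = 0 -> N = 0.
Proof.
move=> /matrixP NNT; apply/matrixP => i j; have := NNT i i.
rewrite !mxE => /eqP; rewrite psumr_eq0 => [/allP/(_ j)|k _]; last first.
  by rewrite mxE -expr2 sqr_ge0.
by rewrite mem_index_enum mxE mulf_eq0 orbb => /(_ isT)/eqP.
Qed.

(* With K a generalized inverse of A A^T, the matrix W = A^T K satisfies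
   A W A = A with W A symmetric, and W A X is the Moore-Penrose inverse. *)
Lemma moore_penrose_exists (R : realType) (m n : nat)
    (A : 'M[R]_(m, n)) (X : 'M[R]_(n, m)) :
  A *m X *m A = A -> (A *m X)^T = A *m X ->
  exists Y, is_moore_penrose A Y.
Proof.
move=> AXA AXT; pose K := pinvmx (A *m A^T); pose W := A^T *m K.
have AWA : A *m W *m A = A.
  apply/eqP; rewrite -subr_eq0; apply/eqP/mulmx_tr_eq0.
  (* The generalized inverse property of [K] kills [N A^T] for [N = A W A - A]. As [N^T] has [A^T]
     as left factor, [N N^T = 0] follows. *)
  have NAT : (A *m W *m A - A) *m A^T = 0.
    by rewrite mulmxBl -(mulmxA _ A) /W (mulmxA A) mulmxKpV ?subrr.
  have defN : A *m W *m A - A = (A *m W - 1%:M) *m A by rewrite mulmxBl mul1mx.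
  by rewrite [in X in _ *m X]defN trmx_mul mulmxA NAT mul0mx.
have WAT : (W *m A)^T = W *m A.
  (* [W A] equals its own Gram matrix, since [(W A)^T A^T = (A W A)^T = A^T]; a Gram matrix is
     symmetric. *)
  have WAWA : (W *m A)^T *m (W *m A) = W *m A.
    have defWA : W *m A = A^T *m (K *m A) by rewrite mulmxA.
    by rewrite [in X in _ *m X]defWA mulmxA -trmx_mul (mulmxA A W) AWA.
  by rewrite -[in LHS]WAWA trmx_mul trmxK.
clearbody W; exists (W *m A *m X); split.
- by rewrite !mulmxA AWA AXA.
- by rewrite -!mulmxA (mulmxA A X) (mulmxA (A *m X)) AXA (mulmxA A W)
    (mulmxA (A *m W)) AWA.
- by rewrite !mulmxA AWA.
- by rewrite -!mulmxA (mulmxA A) AXA.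
Qed.

Lemma mulmx_moore_penrose (R : realType) (m n : nat)
    (A : 'M[R]_(m, n)) (X : 'M[R]_(n, m)) :
  A *m X *m A = A -> (A *m X)^T = A *m X -> A *m moore_penrose A = A *m X.
Proof.
move=> AXA AXT; have [Y mpY] := moore_penrose_exists AXA AXT.
(* Existence excludes the default value [0] of [xget]. *)
have [APA _ APT _] : is_moore_penrose A (moore_penrose A).
  exact: (xgetPex 0 (ex_intro _ Y mpY)).
exact: eq_left_projector.
Qed.

Theorem theorem3p9 (R : realType) (n r : nat) (A B : 'M[R]_n)
    (rankA : \rank A = r)
    (dcgi_ex : exists G : 'M[dual R]_n,
       is_core_inverse (A%:D + eps *: B%:D) G) :
  core_inverse (A%:D + eps *: B%:D)
    = (core_inverse A)%:D
      - eps *: (core_inverse A *m B *m core_inverse A)%:D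
  <-> index_one A /\ (1%:M - A *m moore_penrose A) *m B = 0.
Proof.
have cG := core_inverseP dcgi_ex.
(* The standard part of a dual core inverse is a core inverse of [A]. *)
have cX : is_core_inverse A (core_inverse A).
  have [G cG'] := dcgi_ex; have [X [Y defG]] := dual_mxP G.
  rewrite defG in cG'; have [cX _] := (is_core_inverse_dual A B X Y).1 cG'.
  by apply: core_inverseP; exists X.
have [AXA _ AXT] := cX.
(* The condition on [B] becomes [B - A X B = 0], with [X] the core inverse of [A]. *)
rewrite (mulmx_moore_penrose AXA AXT) mulmxBl mul1mx -scalerN -map_mxN.
have first_order := is_core_inverse_dual_first_order B cX.
split=> [defG|[_ /subr0_eq/esym AXB]].
  split; first exact: core_inverse_rank cX.
  by rewrite defG in cG; rewrite first_order.1 ?subrr.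
exact: dual_core_inverse_uniq cG (first_order.2 AXB).
Qed.
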